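(* There is an adjunction $$\phi_!:\mathsf{PA}\rightleftarrows\mathsf{CA}:\phi^*$$ between the category $\mathsf{PA}$ of oriented planar algebras and the category $\mathsf{CA}$ of oriented circuit algebras, with $\phi_!$ left adjoint to $\phi^*$, where $\phi^*$ is the restriction functor along the map $\phi$ that regards oriented planar tangles as oriented wiring diagrams.
   Context: $\Bbbk$ is a field of characteristic zero; vector spaces and tensor products are over $\Bbbk$, and an empty tensor product is $\Bbbk$. $\mathcal I$ is a fixed countable set of labels, containing the positive integers. Wiring diagrams. An oriented wiring diagram with $r\ge 0$ inputs is a triple $D=(\mathcal A,M,f)$ where: (i) $\mathcal A=(A_0^{out},A_0^{in},A_1^{out},A_1^{in},\dots,A_r^{out},A_r^{in})$ is a list of finite subsets of $\mathcal I$ (index $0$: output labels; indices $1,\dots,r$: input labels); (ii) $M$ is an oriented compact 1-manifold with boundary, i.e. a finite disjoint union of oriented intervals and oriented circles; $\partial M^{out}$ is the set of beginning points and $\partial M^{in}$ the set of ending points of its intervals; (iii) $f$ is a pair of bijections $\partial M^{out}\to\bigsqcup_{i=0}^rA_i^{out}$ and $\partial M^{in}\to\bigsqcup_{i=0}^rA_i^{in}$. Diagrams are taken up to orientation-preserving homeomorphism of $M$ compatible with $f$. Composition. Let $D=(\mathcal A,M,f)$ have $r$ inputs, $D'=(\mathcal B,N,g)$ have $s$ inputs, $1\le i\le r$, $A_i^{out}=B_0^{in}$ and $A_i^{in}=B_0^{out}$. Then $D\circ_iD'$ has label sets $A_0^{out/in},\dots,A_{i-1}^{out/in},B_1^{out/in},\dots,B_s^{out/in},A_{i+1}^{out/in},\dots,A_r^{out/in}$;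 its manifold is obtained by gluing $M$ and $N$ along the boundary points of $M$ labelled by $A_i^{out}$ (resp. $A_i^{in}$) and those of $N$ with the same labels in $B_0^{in}$ (resp. $B_0^{out}$); its boundary bijection is given by $f$ and $g$ on the remaining points. Circuit algebras. An oriented circuit algebra $\mathsf V$ is a family of vector spaces $\mathsf V[S^{out};S^{in}]$ indexed by pairs of finite subsets of $\mathcal I$, with a linear map $F_D:\mathsf V[A_1^{out};A_1^{in}]\otimes\cdots\otimes\mathsf V[A_r^{out};A_r^{in}]\to\mathsf V[A_0^{in};A_0^{out}]$ for each wiring diagram $D$, such that: (1) $F_{D\circ_iD'}=F_D\circ(\mathrm{Id}\otimes\cdots\otimes F_{D'}\otimes\cdots\otimes\mathrm{Id})$, with $F_{D'}$ in slot $i$; (2) for $\sigma\in\mathcal S_r$, if $\sigma D$ is $D$ with input sets reordered as $A_{\sigma(1)}^{out/in},\dots,A_{\sigma(r)}^{out/in}$, then $F_{\sigma D}=F_D\circ\sigma^{-1}$, where $\sigma^{-1}$ permutes the tensor factors back to the order $1,\dots,r$; (3) for the identity diagram with one input, $A_0^{out}=A_1^{in}=S$, $A_0^{in}=A_1^{out}=T$, whose manifold consists of intervals joining each label of $A_1$ to the same label of $A_0$, $F_D$ is the identity of $\mathsf V[T;S]$. Morphisms are families of linear maps commuting with all $F_D$. The category is $\mathsf{CA}$. Planar tangles. A sign sequence is a finite sequence of elements of $\{+1,-1\}$. An oriented planar tangle of type $(s_1,\dots,s_r;s_0)$ lives in a disc with $r$ holes $D_0\setminus(\mathring D_1\sqcup\dots\sqcup\mathring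 D_r)$ (numbered disjoint closed discs $D_1,\dots,D_r$ in the interior of $D_0$). On each circle $\partial D_i$ there is a base point and a sequence of equidistant marked points, numbered in cyclic order from the base point, the $j$th carrying the sign $s_{i,j}$. The tangle is a compact oriented 1-manifold $M$ embedded in the disc with holes, with $\partial M$ mapped bijectively to the marked points, such that a marked point is positive exactly when the strand through it is directed into the disc $D_i$ bounded by its circle (so on the input circles, $i\ge 1$, positive points are ending points of $M$; on the output circle, $i=0$, positive points are beginning points of $M$). Tangles are considered up to isotopy. If the sign sequence of the output circle of $T'$ equals that of the $i$th input circle of $T$, then $T\circ_iT'$ is obtained by shrinking $T'$, gluing it into the $i$th hole of $T$ matching base points and marked points, and erasing the circle; the holes of $T'$ are numbered in place of the $i$th hole of $T$. These tangles form a coloured operad (colours: sign sequences), symmetric groups renumbering the holes. Planar algebras. An oriented planar algebra $\mathsf P$ is an algebra over this coloured operad: vector spaces $\mathsf P(s)$ indexed by sign sequences and a linear map $Z_T:\mathsf P(s_1)\otimes\cdots\otimes\mathsf P(s_r)\to\mathsf P(s_0)$ for each tangle $T$ of type $(s_1,\dots,s_r;s_0)$, compatible with compositions $\circ_i$, with identity tangles (which act as identities), and with renumbering of holes. Morphisms are families of linear maps commuting with all $Z_T$. The category is $\mathsf{PA}$. The map $\phi$ and $\phi^*$. A planar tangle $T$ of type $(s_1,\dots,s_r;s_0)$ gives a wiring diagram $\phi(T)$ by forgetting the embedding of the interior of $M$ and remembering only the identification of $\partial M$ with the marked points, with $A_i^{in}=\{j:s_{i,j}=+1\}$, $A_i^{out}=\{j:s_{i,j}=-1\}$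 for $i\ge1$, and $A_0^{out}=\{j:s_{0,j}=+1\}$, $A_0^{in}=\{j:s_{0,j}=-1\}$. This is compatible with composition and renumbering. For a circuit algebra $\mathsf V$, $\phi^*\mathsf V$ is the planar algebra with $(\phi^*\mathsf V)(s)=\mathsf V[\{j:s_j=-1\};\{j:s_j=+1\}]$ and $Z_T=F_{\phi(T)}$. *)

(* Defs.v *)
From HB Require Import structures.
From mathcomp Require Import all_boot all_order all_algebra all_fingroup finmap.
From mathcomp Require Import all_classical all_reals all_analysis.
From mathcomp Require Import complex lra.

Set Implicit Arguments.
Unset Strict Implicit.
Unset Printing Implicit Defensive.

Import Order.TTheory GRing.Theory Num.Theory numFieldNormedType.Exports.

Local Open Scope classical_set_scope.
Local Open Scope ring_scope.

Record category := Category {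
  Ob : Type;
  Hom : Ob -> Ob -> Type;
  idm : forall X, Hom X X;
  compm : forall X Y Z, Hom Y Z -> Hom X Y -> Hom X Z;
  compm_idl : forall X Y (f : Hom X Y), compm (idm Y) f = f;
  compm_idr : forall X Y (f : Hom X Y), compm f (idm X) = f;
  compmA : forall X Y Z W (h : Hom Z W) (g : Hom Y Z) (f : Hom X Y),
    compm h (compm g f) = compm (compm h g) f }.

Arguments idm {c} X.
Arguments compm {c X Y Z}.

Record functor (C D : category) := Functor {
  fobj :> Ob C -> Ob D;
  fmap : forall X Y, Hom X Y -> Hom (fobj X) (fobj Y);
  fmap_id : forall X, fmap (idm X) = idm (fobj X);
  fmap_comp : forall X Y Z (g : Hom Y Z) (f : Hom X Y),
    fmap (compm g f) = compm (fmap g) (fmap f) }.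

Arguments fmap {C D} F {X Y} : rename.

Definition left_adjoint (C D : category) (L : functor C D) (G : functor D C) :=
  exists Phi : forall X Y, Hom (L X) Y -> Hom X (G Y),
    (forall X Y, bijective (Phi X Y)) /\
    (forall X X' Y Y' (f : Hom X' X) (g : Hom Y Y') (h : Hom (L X) Y),
      Phi X' Y' (compm g (compm h (fmap L f))) =
      compm (fmap G g) (compm (Phi X Y h) f)).

(* The inputs of a partial composite D \o_i D', in order: inputs 0, .., i-1 of
   D (tagged inl), all inputs of D' (tagged inr), inputs i+1, .. of D. *)
Definition slots (r s : nat) (i : 'I_r) : seq ('I_r + 'I_s) :=
  [seq inl j | j <- take i (enum 'I_r)] ++ [seq inr j | j <- enum 'I_s]
  ++ [seq inl j | j <- drop i.+1 (enum 'I_r)].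

Definition slot (r s : nat) (i : 'I_r) (k : 'I_(size (slots s i))) :
  'I_r + 'I_s := tnth (in_tuple (slots s i)) k.

Arguments slot {r s} i k.

(* A coloured operad whose operations are equivalence classes of concrete
   representatives (isotopy classes of tangles, homeomorphism classes of
   diagrams).  An element of [op cs c] is a representative of an operation with
   r inputs, coloured by cs, and output colour c; the structure is given by
   relations between representatives:
   - [op_eq D D'] : D and D' represent the same operation;
   - [op_comp D D' D''] : D'' represents D \o_i D';
   - [op_act s D D'] : D' represents D with its inputs reordered as
     s(0), .., s(r-1);
   - [op_unit D] : D represents the identity.
   In [op_comp], the colours of the inputs of D and D' are the restrictions of
   a single family e; the output colour of D' is that of the i-th input of D. *)
Record operad := Operad {
  colour : Type;
  op : forall r, ('I_r -> colour) -> colour -> Type;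
  op_eq : forall r (cs : 'I_r -> colour) c, op cs c -> op cs c -> Prop;
  op_comp : forall r s (e : 'I_r + 'I_s -> colour) c (i : 'I_r),
    op (fun j => e (inl j)) c -> op (fun j => e (inr j)) (e (inl i)) ->
    op (fun k => e (slot i k)) c -> Prop;
  op_act : forall r (cs : 'I_r -> colour) c (s : 'S_r),
    op cs c -> op (fun j => cs (s j)) c -> Prop;
  op_unit : forall c, op (fun _ : 'I_1 => c) c -> Prop }.

Section Algebras.

Variable k : fieldType.

(* Linear maps out of U_0 \otimes .. \otimes U_(r-1); for r = 0 there is no
   condition, and a map is the choice of a vector of W. *)
Definition multilinear (r : nat) (U : 'I_r -> lmodType k) (W : lmodType k)
    (F : (forall j, U j) -> W) : Prop :=
  forall (i : 'I_r) (a : k) (x y z : forall j, U j),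
    z i = a *: x i + y i ->
    (forall j, j != i -> x j = z j /\ y j = z j) ->
    F z = a *: F x + F y.

Record algebra_data (O : operad) := AlgebraData {
  carrier :> colour O -> lmodType k;
  act : forall r (cs : 'I_r -> colour O) c,
    op cs c -> (forall j, carrier (cs j)) -> carrier c }.

Record is_algebra (O : operad) (V : algebra_data O) : Prop := IsAlgebra {
  act_multilinear : forall r (cs : 'I_r -> colour O) c (D : op cs c),
    multilinear (@act O V r cs c D);
  act_eq : forall r (cs : 'I_r -> colour O) c (D D' : op cs c),
    op_eq D D' -> forall x : forall j, V (cs j), act D x = act D' x;
  act_comp : forall r s (e : 'I_r + 'I_s -> colour O) c (i : 'I_r)
      (D : op (fun j => e (inl j)) c)
      (D' : op (fun j => e (inr j)) (e (inl i)))
      (D'' : op (fun k => e (slot i k)) c),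
    op_comp D D' D'' ->
    (* x consists of inputs for D' and for D, with the output of D' in slot i *)
    forall x : forall z, V (e z),
    x (inl i) = act D' (fun j => x (inr j)) ->
    act D'' (fun k => x (slot i k)) = act D (fun j => x (inl j));
  act_act : forall r (cs : 'I_r -> colour O) c (s : 'S_r) (D : op cs c)
      (D' : op (fun j => cs (s j)) c),
    op_act D D' ->
    forall x : forall j, V (cs j), act D' (fun j => x (s j)) = act D x;
  act_unit : forall c (D : op (fun _ : 'I_1 => c) c),
    op_unit D -> forall x : 'I_1 -> V c, act D x = x ord0 }.

Record algebra (O : operad) := Algebra {
  algebra_sort :> algebra_data O;
  algebraP : is_algebra algebra_sort }.

Definition is_algebra_hom (O : operad) (V W : algebra_data O)
    (f : forall c, V c -> W c) : Prop :=
  (forall c, linear (f c)) /\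
  (forall r (cs : 'I_r -> colour O) c (D : op cs c) (x : forall j, V (cs j)),
    f c (act D x) = act D (fun j => f (cs j) (x j))).

Record algebra_hom (O : operad) (V W : algebra_data O) := AlgebraHom {
  hom_fun :> forall c, V c -> W c;
  hom_funP : is_algebra_hom hom_fun }.

Lemma algebra_hom_eq (O : operad) (V W : algebra_data O)
  (f g : algebra_hom V W) : (forall c x, f c x = g c x) -> f = g.
Proof.
case: f g => f fP [g gP] /= fg.
have {}fg : f = g by apply: functional_extensionality_dep => c; exact/funext.
by subst g; rewrite (Prop_irrelevance fP gP).
Qed.

Lemma id_is_hom (O : operad) (V : algebra_data O) :
  is_algebra_hom (fun c (x : V c) => x).
Proof. by split. Qed.

Lemma comp_is_hom (O : operad) (U V W : algebra_data O)
  (g : algebra_hom V W) (f : algebra_hom U V) :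
  is_algebra_hom (fun c x => g c (f c x)).
Proof.
case: f g => f [f1 f2] [g [g1 g2]]; split=> [c a x y /=|r cs c D x /=].
  by rewrite f1 g1.
by rewrite f2 g2.
Qed.

Definition algebra_category (O : operad) : category.
Proof.
apply: (@Category (algebra O) (fun V W => algebra_hom V W)
  (fun V => AlgebraHom (@id_is_hom O V))
  (fun U V W g f => AlgebraHom (comp_is_hom g f))).
- by move=> V W f; apply: algebra_hom_eq.
- by move=> V W f; apply: algebra_hom_eq.
- by move=> U V W X h g f; apply: algebra_hom_eq.
Defined.

Variables O O' : operad.

Record operad_map := OperadMap {
  map_col :> colour O -> colour O';
  map_op : forall r (cs : 'I_r -> colour O) c,
    op cs c -> op (fun j => map_col (cs j)) (map_col c);
  map_eq : forall r (cs : 'I_r -> colour O) c (D D' : op cs c),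
    op_eq D D' -> op_eq (map_op D) (map_op D');
  map_comp : forall r s (e : 'I_r + 'I_s -> colour O) c (i : 'I_r)
      (D : op (fun j => e (inl j)) c)
      (D' : op (fun j => e (inr j)) (e (inl i)))
      (D'' : op (fun k => e (slot i k)) c),
    op_comp D D' D'' ->
    op_comp (e := fun z => map_col (e z)) (map_op D) (map_op D') (map_op D'');
  map_act : forall r (cs : 'I_r -> colour O) c (s : 'S_r) (D : op cs c)
      (D' : op (fun j => cs (s j)) c),
    op_act D D' ->
    op_act (cs := fun j => map_col (cs j)) (map_op D) (map_op D');
  map_unit : forall c (D : op (fun _ : 'I_1 => c) c),
    op_unit D -> op_unit (map_op D) }.

Variable phi : operad_map.

Definition restrict_data (V : algebra_data O') : algebra_data O :=
  AlgebraData (carrier := fun c => V (phi c))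
    (fun r cs c D x => act (map_op phi D) x).

Lemma restrict_is_algebra (V : algebra O') : is_algebra (restrict_data V).
Proof.
case: (algebraP V) => h1 h2 h3 h4 h5; split=> [r cs c D|r cs c D D' DD' x
  |r s e c i D D' D'' DD' x xi|r cs c s D D' DD' x|c D Du x] /=.
- exact: h1.
- exact: h2 (map_eq _ DD') x.
- exact: h3 (map_comp phi DD') x xi.
- exact: h4 (map_act phi DD') x.
- exact: h5 (map_unit phi Du) x.
Qed.

Definition restrict_obj (V : algebra O') : algebra O :=
  Algebra (restrict_is_algebra V).

Lemma restrict_is_hom (V W : algebra O') (f : algebra_hom V W) :
  is_algebra_hom (V := restrict_obj V) (W := restrict_obj W)
    (fun c x => f (phi c) x).
Proof. by case: f => f [f1 f2]; split=> [c|r cs c D x]; [exact: f1|exact: f2]. Qed.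

Definition restriction :
  functor (algebra_category O') (algebra_category O).
Proof.
apply: (@Functor (algebra_category O') (algebra_category O) restrict_obj
  (fun V W f => AlgebraHom (restrict_is_hom f))).
- by move=> V; apply: algebra_hom_eq.
- by move=> U V W g f; apply: algebra_hom_eq.
Defined.

End Algebras.

Section Manifolds.

Variable R : realType.

(* The oriented compact 1-manifold consisting of nint copies of [0, 1] and
   ncirc copies of R/Z, both oriented by increasing parameter. *)
Record manifold := Manifold { nint : nat; ncirc : nat }.

Definition component (M : manifold) := ('I_(nint M) + 'I_(ncirc M))%type.

(* Points are given by a component and a parameter, in [0, 1] for intervals and
   in R for circles (see [in_mfd]); [same_pt] identifies parameters mod Z on
   circles. *)
Definition point (M : manifold) := (component M * R)%type.

Definition in_mfd (M : manifold) : set (point M) :=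
  [set p | if p.1 is inl _ then 0 <= p.2 <= 1 else True].

Definition same_pt (M : manifold) (p q : point M) : Prop :=
  p.1 = q.1 /\
  if p.1 is inl _ then p.2 = q.2 else exists n : int, q.2 = p.2 + n%:~R.

Definition beg_pt (M : manifold) (a : 'I_(nint M)) : point M := (inl a, 0).
Definition end_pt (M : manifold) (a : 'I_(nint M)) : point M := (inl a, 1).

(* f lifts an orientation-preserving topological embedding of M in N: on each
   component it is a continuous increasing function of the parameter. *)
Definition oembedding (M N : manifold) (f : point M -> point N) : Prop :=
  [/\ forall p, in_mfd p -> in_mfd (f p),
      forall c t t', (f (c, t)).1 = (f (c, t')).1,
      forall c, {within [set t | in_mfd (c, t)],
        continuous (fun t => (f (c, t)).2)},
      forall c t t', in_mfd (c, t) -> in_mfd (c, t') -> t < t' ->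
        (f (c, t)).2 < (f (c, t')).2 &
      forall p q, in_mfd p -> in_mfd q ->
        (same_pt (f p) (f q) <-> same_pt p q)].

Definition ohomeo (M N : manifold) (f : point M -> point N) : Prop :=
  oembedding f /\
  forall q, in_mfd q -> exists2 p, in_mfd p & same_pt (f p) q.

End Manifolds.

Arguments beg_pt {R M}.
Arguments end_pt {R M}.

(* Boundary circles of a disc with r holes, or label sets of a wiring diagram:
   None is the output (index 0), Some i the i-th input. *)
Definition site (r : nat) := option 'I_r.

Definition comp_site (r s : nat) (i : 'I_r)
    (o : site (size (slots s i))) : site r + site s :=
  match o with
  | None => inl None
  | Some k => match slot i k with inl j => inl (Some j) | inr j => inr (Some j) end
  end.

Section WiringDiagrams.

Variables (R : realType) (I : countType).

(* The colour (A, B) is the index of V[A; B].  Hence an input i has colour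
   (A_i^out, A_i^in), but the output has colour (A_0^in, A_0^out). *)
Definition wcolour := ({fset I} * {fset I})%type.

Section Wiring.
Variables (r : nat) (cs : 'I_r -> wcolour) (c : wcolour).

Definition out_set (o : site r) : {fset I} :=
  if o is Some i then (cs i).1 else c.2.
Definition in_set (o : site r) : {fset I} :=
  if o is Some i then (cs i).2 else c.1.

Record wiring := Wiring {
  wmfd : manifold;
  wbeg : 'I_(nint wmfd) -> site r * I;
  wend : 'I_(nint wmfd) -> site r * I;
  wbeg_bij : set_bij setT [set p | p.2 \in out_set p.1] wbeg;
  wend_bij : set_bij setT [set p | p.2 \in in_set p.1] wend }.
End Wiring.

(* f maps boundary points of D to boundary points of D' along the
   correspondence g between sites. *)
Definition bdry_compat r (cs : 'I_r -> wcolour) c r' (cs' : 'I_r' -> wcolour) c'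
    (D : wiring cs c) (D' : wiring cs' c') (g : site r -> site r' -> Prop)
    (f : point R (wmfd D) -> point R (wmfd D')) : Prop :=
  (forall a a', g (wbeg a).1 (wbeg a').1 -> (wbeg a).2 = (wbeg a').2 ->
    same_pt (f (beg_pt a)) (beg_pt a')) /\
  (forall a a', g (wend a).1 (wend a').1 -> (wend a).2 = (wend a').2 ->
    same_pt (f (end_pt a)) (end_pt a')).

Definition wiring_eq r (cs : 'I_r -> wcolour) c (D D' : wiring cs c) : Prop :=
  exists2 f, ohomeo f & bdry_compat (D := D) (D' := D') eq f.

Definition glued_at r (cs : 'I_r -> wcolour) c s (ds : 'I_s -> wcolour) d
    (D : wiring cs c) (D' : wiring ds d) (i : 'I_r)
    (p : point R (wmfd D)) (q : point R (wmfd D')) : Prop :=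
  exists (l : I) a b,
    [/\ p = beg_pt a, wbeg a = (Some i, l), q = end_pt b & wend b = (None, l)]
    \/
    [/\ p = end_pt a, wend a = (Some i, l), q = beg_pt b & wbeg b = (None, l)].

(* The manifold of D'' is the gluing of those of D and D': it is covered by
   copies of them that meet exactly in the identified points. *)
Definition wiring_comp r s (e : 'I_r + 'I_s -> wcolour) c (i : 'I_r)
    (D : wiring (fun j => e (inl j)) c)
    (D' : wiring (fun j => e (inr j)) (e (inl i)))
    (D'' : wiring (fun k => e (slot i k)) c) : Prop :=
  exists (f : point R (wmfd D) -> point R (wmfd D''))
         (f' : point R (wmfd D') -> point R (wmfd D'')),
  [/\ oembedding f /\ oembedding f',
      forall q, in_mfd q -> (exists2 p, in_mfd p & same_pt (f p) q) \/
                            (exists2 p, in_mfd p & same_pt (f' p) q),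
      forall p p', in_mfd p -> in_mfd p' ->
        (same_pt (f p) (f' p') <-> glued_at i p p'),
      bdry_compat (D := D) (D' := D'') (fun o o'' => comp_site o'' = inl o) f &
      bdry_compat (D := D') (D' := D'') (fun o o'' => comp_site o'' = inr o) f'].

Definition wiring_act r (cs : 'I_r -> wcolour) c (s : 'S_r) (D : wiring cs c)
    (D' : wiring (fun j => cs (s j)) c) : Prop :=
  exists2 f, ohomeo f &
    bdry_compat (D := D') (D' := D) (fun o' o => omap s o' = o) f.

Definition wiring_unit c (D : wiring (fun _ : 'I_1 => c) c) : Prop :=
  ncirc (wmfd D) = 0%N /\
  forall a : 'I_(nint (wmfd D)),
    (wbeg a).1 != (wend a).1 /\ (wbeg a).2 = (wend a).2.

Definition wiring_operad : operad :=
  Operad wiring_eq wiring_comp wiring_act wiring_unit.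

End WiringDiagrams.

Section PlanarTangles.

Variable R : realType.

Definition plane : numFieldType := R[i].

(* A closed disc with a base point, base - ctr, on its boundary circle. *)
Record bdisc := BDisc { ctr : plane; bvec : plane; bvec_neq0 : bvec != 0 }.

Definition closed_disc (d : bdisc) : set plane :=
  [set z | `|z - ctr d| <= `|bvec d|].
Definition open_disc (d : bdisc) : set plane :=
  [set z | `|z - ctr d| < `|bvec d|].

Definition cis (t : R) : plane := Complex (cos t) (sin t).

(* n equidistant points on the unit circle, counterclockwise, the point 1 being
   in the middle of the arc from the last one to the first one *)
Definition unit_mark (n j : nat) : plane :=
  cis (pi * (j.*2.+1)%:R / n%:R).

Definition mark (d : bdisc) (n j : nat) : plane :=
  ctr d + bvec d * unit_mark n j.

(* The similarity from the disc d' to the disc d that matches base points. *)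
Definition shrink (d' d : bdisc) (z : plane) : plane :=
  ctr d + bvec d * ((z - ctr d') / bvec d').

(* A sign sequence; true is +1 and false is -1. *)
Definition signs := seq bool.

Section Tangle.
Variables (r : nat) (ss : 'I_r -> signs) (s0 : signs).

Definition site_signs (o : site r) : signs := if o is Some i then ss i else s0.

(* Marked point p.2 of the circle p.1 is a beginning point iff its sign is +1
   on the output circle, -1 on an input circle. *)
Definition beg_marks : set (site r * nat) :=
  [set p | (p.2 < size (site_signs p.1))%N /\
           nth true (site_signs p.1) p.2 = (p.1 == None)].
Definition end_marks : set (site r * nat) :=
  [set p | (p.2 < size (site_signs p.1))%N /\
           nth true (site_signs p.1) p.2 = (p.1 != None)].

Record tangle := Tangle {
  disc : site r -> bdisc;
  holes_inside : forall i,
    closed_disc (disc (Some i)) `<=` open_disc (disc None);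
  holes_disjoint : forall i j, i != j ->
    closed_disc (disc (Some i)) `&` closed_disc (disc (Some j)) = set0;
  tmfd : manifold;
  temb : point R tmfd -> plane;
  temb_continuous : forall c, {within [set t | in_mfd (c, t)],
    continuous (fun t => temb (c, t))};
  temb_inj : forall p q, in_mfd p -> in_mfd q ->
    (temb p = temb q <-> same_pt p q);
  tbeg : 'I_(nint tmfd) -> site r * nat;
  tend : 'I_(nint tmfd) -> site r * nat;
  tbeg_bij : set_bij setT beg_marks tbeg;
  tend_bij : set_bij setT end_marks tend;
  temb_beg : forall a, temb (beg_pt a) =
    mark (disc (tbeg a).1) (size (site_signs (tbeg a).1)) (tbeg a).2;
  temb_end : forall a, temb (end_pt a) =
    mark (disc (tend a).1) (size (site_signs (tend a).1)) (tend a).2;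
  temb_interior : forall p, in_mfd p ->
    (forall a, p <> beg_pt a /\ p <> end_pt a) ->
    open_disc (disc None) (temb p) /\
    forall i, ~ closed_disc (disc (Some i)) (temb p) }.

Definition carries (h : plane -> plane) (T T' : tangle) : Prop :=
  [/\ forall o, h @` closed_disc (disc T o) = closed_disc (disc T' o),
      forall o, h (ctr (disc T o) + bvec (disc T o)) =
                ctr (disc T' o) + bvec (disc T' o),
      forall o j, (j < size (site_signs o))%N ->
        h (mark (disc T o) (size (site_signs o)) j) =
        mark (disc T' o) (size (site_signs o)) j &
      exists2 f : point R (tmfd T) -> point R (tmfd T'), ohomeo f &
        forall p, in_mfd p -> temb (f p) = h (temb p)].

Definition plane_homeo (h : plane -> plane) : Prop :=
  continuous h /\
  exists g : plane -> plane, [/\ continuous g, cancel h g & cancel g h].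

(* T and T' are joined by an isotopy through tangles; the discs and their base
   points may move. *)
Definition isotopic (T T' : tangle) : Prop :=
  exists H : R -> plane -> plane,
  [/\ {within `[0, 1] `*` setT,
        continuous (fun p : R * plane => H p.1 p.2)},
      forall t, 0 <= t <= 1 -> plane_homeo (H t),
      forall z, H 0 z = z,
      forall t, 0 <= t <= 1 -> exists Tt, carries (H t) T Tt &
      carries (H 1) T T'].

End Tangle.

(* T'' is the union of T and of T' shrunk into the i-th hole of T. *)
Definition tangle_comp r s (e : 'I_r + 'I_s -> signs) c (i : 'I_r)
    (T : tangle (fun j => e (inl j)) c)
    (T' : tangle (fun j => e (inr j)) (e (inl i)))
    (T'' : tangle (fun k => e (slot i k)) c) : Prop :=
  let A := shrink (disc T' None) (disc T (Some i)) in
  [/\ forall o'' o, comp_site o'' = inl o -> disc T'' o'' = disc T o,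
      forall o'' o, comp_site o'' = inr o ->
        ctr (disc T'' o'') = A (ctr (disc T' o)) /\
        ctr (disc T'' o'') + bvec (disc T'' o'') =
        A (ctr (disc T' o) + bvec (disc T' o)) &
      exists (f : point R (tmfd T) -> point R (tmfd T''))
             (f' : point R (tmfd T') -> point R (tmfd T'')),
      [/\ oembedding f /\ oembedding f',
          forall p, in_mfd p -> temb (f p) = temb p,
          forall p, in_mfd p -> temb (f' p) = A (temb p) &
          forall q, in_mfd q -> (exists2 p, in_mfd p & same_pt (f p) q) \/
                                (exists2 p, in_mfd p & same_pt (f' p) q)]].

Definition tangle_act r (ss : 'I_r -> signs) c (s : 'S_r) (T : tangle ss c)
    (T' : tangle (fun j => ss (s j)) c) : Prop :=
  (forall o, disc T' o = disc T (omap s o)) /\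
  exists2 f : point R (tmfd T') -> point R (tmfd T), ohomeo f &
    forall p, in_mfd p -> temb (f p) = temb p.

(* A round annulus with radial strands. *)
Definition tangle_unit c (T : tangle (fun _ : 'I_1 => c) c) : Prop :=
  let d0 := disc T None in let d1 := disc T (Some ord0) in
  exists l : R,
  [/\ 0 < l < 1, ctr d1 = ctr d0, bvec d1 = Complex l 0 * bvec d0,
      ncirc (tmfd T) = 0%N &
      forall a : 'I_(nint (tmfd T)), exists2 j, (j < size c)%N &
        forall t, 0 <= t <= 1 -> exists2 u : R, l <= u <= 1 &
          temb (inl a, t) =
          ctr d0 + Complex u 0 * bvec d0 * unit_mark (size c) j].

Definition tangle_operad : operad :=
  Operad (fun r ss c => @isotopic r ss c) tangle_comp tangle_act tangle_unit.

End PlanarTangles.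

Section Phi.

Variables (R : realType) (I : countType) (lab : nat -> I).
Hypothesis lab_inj : injective lab.

(* Marked points are counted from 0, and lab j is the label j + 1. *)
Definition phi_colour (s : signs) : wcolour I :=
  ([fset lab j | j in iota 0 (size s) & ~~ nth true s j],
   [fset lab j | j in iota 0 (size s) & nth true s j])%fset.

Definition phi_label r (p : site r * nat) : site r * I := (p.1, lab p.2).

Lemma phi_label_inj r : injective (@phi_label r).
Proof. by move=> [ o j] [ o' j'] [-> /lab_inj ->]. Qed.

Lemma phi_colour1P s l : l \in (phi_colour s).1 <->
  exists j, [/\ (j < size s)%N, nth true s j = false & l = lab j].
Proof.
split=> [/imfsetP[j /= ]|[j [js sj ->]]].
  by rewrite inE mem_iota add0n /= => /andP[js /negbTE sj] ->; exists j.
by apply/imfsetP; exists j; rewrite //= inE mem_iota add0n js sj.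
Qed.

Lemma phi_colour2P s l : l \in (phi_colour s).2 <->
  exists j, [/\ (j < size s)%N, nth true s j & l = lab j].
Proof.
split=> [/imfsetP[j /= ]|[j [js sj ->]]].
  by rewrite inE mem_iota add0n /= => /andP[js sj] ->; exists j.
by apply/imfsetP; exists j; rewrite //= inE mem_iota add0n js sj.
Qed.

Section PhiTangle.
Variables (r : nat) (ss : 'I_r -> signs) (s0 : signs).

Lemma phi_out_setP (p : site r * I) :
  p.2 \in out_set (fun j => phi_colour (ss j)) (phi_colour s0) p.1 <->
  exists2 q, beg_marks ss s0 q & p = phi_label q.
Proof.
case: p => [[i|] l] /=.
- rewrite phi_colour1P; split=> [[j [js sj ->]]|]; first by exists (Some i, j).
  by move=> [[ o j]] /= [js sj] [oi lj]; subst o; exists j.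
- rewrite phi_colour2P; split=> [[j [js sj ->]]|]; first by exists (None, j).
  by move=> [[ o j]] /= [js sj] [oi lj]; subst o; exists j.
Qed.

Lemma phi_in_setP (p : site r * I) :
  p.2 \in in_set (fun j => phi_colour (ss j)) (phi_colour s0) p.1 <->
  exists2 q, end_marks ss s0 q & p = phi_label q.
Proof.
case: p => [[i|] l] /=.
- rewrite phi_colour2P; split=> [[j [js sj ->]]|]; first by exists (Some i, j).
  by move=> [[ o j]] /= [js sj] [oi lj]; subst o; exists j.
- rewrite phi_colour1P; split=> [[j [js sj ->]]|]; first by exists (None, j).
  by move=> [[ o j]] /= [js sj] [oi lj]; subst o; exists j.
Qed.

Lemma phi_label_bij (n : nat) (A : set (site r * nat)) (B : set (site r * I))
    (f : 'I_n -> site r * nat) :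
  (forall p, B p <-> exists2 q, A q & p = phi_label q) ->
  set_bij setT A f -> set_bij setT B (fun a => phi_label (f a)).
Proof.
move=> BA [fA finj fsurj]; split.
- by move=> a _; apply/BA; exists (f a) => //; apply: fA.
- by move=> a b aT bT /phi_label_inj; apply: finj.
- by move=> p /BA[q /fsurj[a _ <-] ->]; exists a.
Qed.

Variable T : tangle R ss s0.

Definition phi_tangle :
  wiring (fun j => phi_colour (ss j)) (phi_colour s0) :=
  Wiring (phi_label_bij phi_out_setP (tbeg_bij T))
         (phi_label_bij phi_in_setP (tend_bij T)).

End PhiTangle.

Lemma in_beg M (a : 'I_(nint M)) : in_mfd (beg_pt (R := R) a).
Proof. by rewrite /in_mfd /mkset /= lexx ler01. Qed.

Lemma in_end M (a : 'I_(nint M)) : in_mfd (end_pt (R := R) a).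
Proof. by rewrite /in_mfd /mkset /= lexx ler01. Qed.

Lemma phi_eq r (ss : 'I_r -> signs) c (T T' : tangle R ss c) :
  isotopic T T' -> wiring_eq R (phi_tangle T) (phi_tangle T').
Proof.
case=> H [_ _ _ _ [_ _ hm [f [femb fsurj] fT]]].
exists f => //; case: femb => fin _ _ _ _; split=> a a' /= eo /lab_inj jj.
- have aT := @in_beg _ a.
  have aT' := @in_beg _ a'.
  apply/(temb_inj (fin _ aT) aT'); rewrite fT // !temb_beg -eo -jj.
  by apply: hm; have [h _ _] := tbeg_bij T; have [] := h a Logic.I.
- have aT := @in_end _ a.
  have aT' := @in_end _ a'.
  apply/(temb_inj (fin _ aT) aT'); rewrite fT // !temb_end -eo -jj.
  by apply: hm; have [h _ _] := tend_bij T; have [] := h a Logic.I.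
Qed.

Lemma phi_act r (ss : 'I_r -> signs) c (s : 'S_r) (T : tangle R ss c)
    (T' : tangle R (fun j => ss (s j)) c) :
  tangle_act T T' ->
  wiring_act (cs := fun j => phi_colour (ss j)) R (phi_tangle T)
    (phi_tangle T').
Proof.
case=> dd [f [femb fsurj] fT].
exists f => //; case: femb => fin _ _ _ _.
have ssE (o : site r) :
  site_signs ss c (omap s o) = site_signs (fun j => ss (s j)) c o by case: o.
split=> a' a /= eo /lab_inj jj.
- have aT := @in_beg _ a.
  have aT' := @in_beg _ a'.
  by apply/(temb_inj (fin _ aT') aT); rewrite fT // !temb_beg -eo -jj dd ssE.
- have aT := @in_end _ a.
  have aT' := @in_end _ a'.
  by apply/(temb_inj (fin _ aT') aT); rewrite fT // !temb_end -eo -jj dd ssE.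
Qed.

Lemma norm_cis (t : R) : `|cis t| = 1.
Proof. by rewrite normc_def /= cos2Dsin2 sqrtr1. Qed.

Lemma cis_inj (x y : R) : 0 <= x -> y < pi *+ 2 -> x <= y -> cis x = cis y ->
  x = y.
Proof.
move=> x0 y2 xy [cE sE]; apply/eqP; rewrite eq_le xy /= leNgt; apply/negP => xy'.
have c1 : cos (y - x) = 1.
  by rewrite cosB cE sE -!expr2 cos2Dsin2.
pose d := (y - x) / 2.
have yxE : y - x = d *+ 2 by rewrite /d -mulr_natr mulfVK // pnatr_eq0.
have sd : 0 < sin d.
  apply: sin_gt0_pi; rewrite /d divr_gt0 ?subr_gt0 //=.
  rewrite ltr_pdivrMr // mulr_natr; apply: le_lt_trans y2; lra.
move: c1; rewrite yxE cos_mulr2n => /eqP.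
rewrite -subr_eq0 cos2sin2 => /eqP h.
have : sin d ^+ 2 = 0 by lra.
by move/eqP; rewrite sqrf_eq0 (gt_eqF sd).
Qed.

Lemma unit_mark_inj n j j' : (j < n)%N -> (j' < n)%N ->
  unit_mark R n j = unit_mark R n j' -> j = j'.
Proof.
move=> jn j'n.
have n0 : 0 < n%:R :> R by rewrite ltr0n; apply: leq_ltn_trans jn.
have p0 := pi_gt0 R.
have wl : forall j j', (j < n)%N -> (j' < n)%N -> (j <= j')%N ->
    unit_mark R n j = unit_mark R n j' -> j = j'.
  move=> {jn j'n} {}j {}j' jn j'n jj /cis_inj h.
  have : pi * j.*2.+1%:R / n%:R = pi * j'.*2.+1%:R / n%:R :> R.
    apply: h.
    - by rewrite !mulr_ge0 ?invr_ge0 ?ler0n // ltW.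
    - rewrite -mulrA -[pi *+ 2]mulr_natr ltr_pM2l // ltr_pdivrMr // -natrM.
      by rewrite ltr_nat mul2n -doubleS leq_double.
    - rewrite ler_pM2r ?invr_gt0 // ler_pM2l // ler_nat ltnS leq_double //.
  move/(mulIf (invr_neq0 (lt0r_neq0 n0)))/(mulfI (lt0r_neq0 p0))/eqP.
  by rewrite eqr_nat eqSS => /eqP/double_inj.
by case: (leqP j j') => [|/ltnW] jj; [exact: wl|move=> /esym/(wl _ _ j'n jn jj)].
Qed.

Lemma mark_inj (d : bdisc R) n j j' : (j < n)%N -> (j' < n)%N ->
  mark d n j = mark d n j' -> j = j'.
Proof.
by move=> jn j'n /addrI/(mulfI (bvec_neq0 d))/unit_mark_inj; apply.
Qed.

Lemma norm_mark (d : bdisc R) n j : `|mark d n j - ctr d| = `|bvec d|.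
Proof. by rewrite /mark addrAC subrr add0r normrM norm_cis mulr1. Qed.

Lemma shrinkE (d' d : bdisc R) z :
  `|shrink d' d z - ctr d| = `|bvec d| * (`|z - ctr d'| / `|bvec d'|).
Proof. by rewrite /shrink addrAC subrr add0r normrM normf_div. Qed.

Lemma shrink_mark (d' d : bdisc R) n j :
  shrink d' d (mark d' n j) = mark d n j.
Proof.
rewrite /shrink /mark [ctr d' + _]addrC addrK mulrAC mulfV ?mul1r //.
exact: bvec_neq0.
Qed.

Section Boundary.
Variables (r : nat) (ss : 'I_r -> signs) (s0 : signs) (T : tangle R ss s0).

Implicit Type p : point R (tmfd T).

Definition bdry_at (p : point R (tmfd T)) (q : site r * nat) : Prop :=
  (exists2 a, p = beg_pt a & tbeg a = q) \/
  (exists2 a, p = end_pt a & tend a = q).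

Lemma bdry_at_mark p q : bdry_at p q ->
  temb p = mark (disc T q.1) (size (site_signs ss s0 q.1)) q.2.
Proof. by case=> -[a -> <-]; rewrite ?temb_beg ?temb_end. Qed.

Lemma bdry_at_size p q : bdry_at p q ->
  (q.2 < size (site_signs ss s0 q.1))%N.
Proof.
case=> -[a _ <-].
  by have [h _ _] := tbeg_bij T; have [] := h a Logic.I.
by have [h _ _] := tend_bij T; have [] := h a Logic.I.
Qed.

Lemma bdry_or_interior p : (exists q, bdry_at p q) \/
  (forall a, p <> beg_pt a /\ p <> end_pt a).
Proof.
have [|nb] := pselect (exists q, bdry_at p q); [by left|right=> a].
split=> pE; apply: nb; [exists (tbeg a); left|exists (tend a); right]; by exists a.
Qed.

Lemma in_disc p : in_mfd p -> closed_disc (disc T None) (temb p).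
Proof.
move=> pM; case: (bdry_or_interior p) => [[[[i|] j] b]|].
- apply: (ltW (@holes_inside _ _ _ _ T i _ _)); rewrite /closed_disc /mkset.
  by rewrite (bdry_at_mark b) norm_mark.
- by rewrite /closed_disc /mkset (bdry_at_mark b) norm_mark.
- by move=> /(temb_interior pM)[/ltW].
Qed.

Lemma in_hole p i : in_mfd p -> closed_disc (disc T (Some i)) (temb p) ->
  exists j, bdry_at p (Some i, j).
Proof.
move=> pM pi; case: (bdry_or_interior p) => [[[[i'|] j] b]|]; last first.
  by move=> /(temb_interior pM)[_ /(_ i)].
- have := @holes_inside _ _ _ _ T i _ pi.
  by rewrite /open_disc /mkset (bdry_at_mark b) norm_mark ltxx.
have [ii|ii] := eqVneq i i'; first by subst i'; exists j.
have : (closed_disc (disc T (Some i)) `&` closed_disc (disc T (Some i')))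
  (temb p).
  by split=> //; rewrite /closed_disc /mkset (bdry_at_mark b) norm_mark.
by rewrite holes_disjoint.
Qed.

Lemma on_outer p : in_mfd p -> ~ open_disc (disc T None) (temb p) ->
  exists j, bdry_at p (None, j).
Proof.
move=> pM np; case: (bdry_or_interior p) => [[[[i|] j] b]|].
- case: np; apply: (@holes_inside _ _ _ _ _ i).
  by rewrite /closed_disc /mkset (bdry_at_mark b) norm_mark.
- by exists j.
- by move=> /(temb_interior pM)[].
Qed.

End Boundary.

Lemma phi_comp r s (e : 'I_r + 'I_s -> signs) c (i : 'I_r)
    (T : tangle R (fun j => e (inl j)) c)
    (T' : tangle R (fun j => e (inr j)) (e (inl i)))
    (T'' : tangle R (fun k => e (slot i k)) c) :
  tangle_comp T T' T'' ->
  wiring_comp (e := fun z => phi_colour (e z)) R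
    (phi_tangle T) (phi_tangle T') (phi_tangle T'').
Proof.
case=> dT dT' [f [f' [[femb femb'] fE fE' fsurj]]].
have fin : forall p, in_mfd p -> in_mfd (f p) by case: femb.
have fin' : forall p, in_mfd p -> in_mfd (f' p) by case: femb'.
exists f, f'; split=> //.
- move=> p p' pM p'M; rewrite -(temb_inj (fin _ pM) (fin' _ p'M)) fE // fE' //.
  have tbP := @tbeg_bij _ _ _ _ T; have teP := @tend_bij _ _ _ _ T.
  have tbP' := @tbeg_bij _ _ _ _ T'; have teP' := @tend_bij _ _ _ _ T'.
  split=> [pp|[l [a [b [[-> /= al -> bl]|[-> /= al -> bl]]]]]]; last 2 first.
  + rewrite temb_beg temb_end; move: al bl => [-> al] [-> bl] /=.
    by rewrite shrink_mark -[X in _ = mark _ _ X](lab_inj (etrans al (esym bl))).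
  + rewrite temb_beg temb_end; move: al bl => [-> al] [-> bl] /=.
    by rewrite shrink_mark -[X in _ = mark _ _ X](lab_inj (etrans al (esym bl))).
  have v0 : 0 < `|bvec (disc T' None)| by rewrite normr_gt0 bvec_neq0.
  have vi : 0 < `|bvec (disc T (Some i))| by rewrite normr_gt0 bvec_neq0.
  have [j b] : exists j, bdry_at p (Some i, j).
    apply: in_hole => //; rewrite pp /closed_disc /mkset shrinkE.
    rewrite ler_piMr ?(ltW vi) // ler_pdivrMr // mul1r; exact: in_disc.
  have [j' b'] : exists j, bdry_at p' (None, j).
    apply: on_outer => //; rewrite /open_disc /mkset => lt.
    have := norm_mark (disc T (Some i)) (size (e (inl i))) j.
    have := bdry_at_mark b; rewrite pp /= => <-; rewrite shrinkE => h.
    have : `|bvec (disc T (Some i))| *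
      (`|temb p' - ctr (disc T' None)| / `|bvec (disc T' None)|) <
      `|bvec (disc T (Some i))|.
      by rewrite gtr_pMr // ltr_pdivrMr // mul1r.
    by rewrite h ltxx.
  have jj : j = j'.
    apply: (@mark_inj (disc T (Some i)) (size (e (inl i)))).
    - exact: bdry_at_size b.
    - exact: bdry_at_size b'.
    - have := bdry_at_mark b; rewrite pp (bdry_at_mark b') /= => <-.
      by rewrite shrink_mark.
  subst j'; exists (lab j).
  case: b b' => -[a -> aj] [] [b -> bj]; exists a, b.
  + have [ha _ _] := tbP; have [_ /=] := ha a Logic.I => {ha}.
    have [hb _ _] := tbP'; have [_ /=] := hb b Logic.I => {hb}.
    by rewrite aj bj /= => ->.
  + by left; rewrite /= aj bj.
  + by right; rewrite /= aj bj.
  + have [ha _ _] := teP; have [_ /=] := ha a Logic.I => {ha}.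
    have [hb _ _] := teP'; have [_ /=] := hb b Logic.I => {hb}.
    by rewrite aj bj /= => ->.
- have ssE o'' o : comp_site o'' = inl o ->
    site_signs (fun k => e (slot i k)) c o'' =
    site_signs (fun j => e (inl j)) c o.
    by case: o'' => [k|] /=; [case: (slot i k) => // j|] => -[<-].
  split=> a a'' /= eo /lab_inj jj.
  + apply/(temb_inj (fin _ (in_beg _)) (in_beg _)); rewrite fE; last exact: in_beg.
    by rewrite !temb_beg (dT _ _ eo) (ssE _ _ eo) jj.
  + apply/(temb_inj (fin _ (in_end _)) (in_end _)); rewrite fE; last exact: in_end.
    by rewrite !temb_end (dT _ _ eo) (ssE _ _ eo) jj.
- have ssE o'' o : comp_site (i := i) o'' = inr o ->
    site_signs (fun k => e (slot i k)) c o'' =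
    site_signs (fun j => e (inr j)) (e (inl i)) o.
    by case: o'' => [k|] //=; case: (slot i k) => // j -[<-].
  have mE o'' o n j : comp_site (i := i) o'' = inr o ->
    mark (disc T'' o'') n j =
    shrink (disc T' None) (disc T (Some i)) (mark (disc T' o) n j).
    move=> /dT'[h1 h2]; rewrite /mark.
    have -> : bvec (disc T'' o'') =
        bvec (disc T (Some i)) * (bvec (disc T' o) / bvec (disc T' None)).
      apply: (addrI (ctr (disc T'' o''))); rewrite h2 h1 /shrink.
      by rewrite -[RHS]addrA -mulrDr -mulrDl addrAC.
    rewrite h1 /shrink -[LHS]addrA -[_ * unit_mark _ _ _]mulrA -mulrDr.
    by rewrite [_ / _ * unit_mark _ _ _]mulrAC -mulrDl addrAC.
  split=> a a'' /= eo /lab_inj jj.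
  + apply/(temb_inj (fin' _ (in_beg _)) (in_beg _)); rewrite fE'; last exact: in_beg.
    by rewrite !temb_beg -(mE _ _ _ _ eo) (ssE _ _ eo) jj.
  + apply/(temb_inj (fin' _ (in_end _)) (in_end _)); rewrite fE'; last exact: in_end.
    by rewrite !temb_end -(mE _ _ _ _ eo) (ssE _ _ eo) jj.
Qed.

Lemma phi_unit c (T : tangle R (fun _ : 'I_1 => c) c) :
  tangle_unit T -> wiring_unit (phi_tangle T).
Proof.
case=> l [/andP[l0 l1] cE vE circ hT]; split=> // a /=.
have [j jc ha] := hT a.
have cplx_inj (u v : R) : Complex u 0 = Complex v 0 :> plane R -> u = v by case.
have normR (u : R) : 0 < u -> `|Complex u 0 : plane R| = Complex u 0.
  by move=> u0; rewrite normc_def /= expr0n addr0 sqrtr_sqr gtr0_norm.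
have site0 (o : site 1) : o = None \/ o = Some ord0.
  by case: o => [k|]; [right; rewrite (ord1 k)|left].
have key (o : site 1) k : (k < size c)%N -> forall u : R, l <= u ->
    mark (disc T o) (size (site_signs (fun=> c) c o)) k =
      ctr (disc T None) + Complex u 0 * bvec (disc T None) *
        unit_mark R (size c) j ->
    k = j /\ u = if o is None then 1 else l.
  move=> kc u lu.
  have [m [m0 mE vE']] : exists m : R, [/\ 0 < m,
      m = (if o is None then 1 else l) &
      bvec (disc T o) = Complex m 0 * bvec (disc T None)].
    case: (site0 o) => ->; [exists 1|exists l]; split=> //; exact: esym (mul1r _).
  have -> : size (site_signs (fun=> c) c o) = size c by case: (o).
  have -> : mark (disc T o) (size c) k = ctr (disc T None) +
      Complex m 0 * bvec (disc T None) * unit_mark R (size c) k.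
    by rewrite /mark vE'; case: (site0 o) => ->; rewrite ?cE.
  rewrite -mE => /addrI h.
  have u0 : 0 < u by exact: lt_le_trans lu.
  have mu : m = u.
    have := congr1 Num.norm h; rewrite !normrM !norm_cis !mulr1.
    move/mulIf; rewrite normr_eq0 bvec_neq0 !normR // => /(_ isT).
    exact: cplx_inj.
  split=> //; rewrite -mu in h; apply: (unit_mark_inj kc jc).
  by apply: (mulfI _ h); rewrite mulf_neq0 ?bvec_neq0 // -normr_gt0 normR // ltcR.
have [u0 /andP[lu0 _] h0] := ha 0 ltac:(by rewrite lexx ler01).
have [u1 /andP[lu1 _] h1] := ha 1 ltac:(by rewrite lexx ler01).
have szE (o : site 1) : size (site_signs (fun=> c) c o) = size c by case: o.
have [hb _ _] := tbeg_bij T; have [kb _] := hb a Logic.I.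
have [he _ _] := tend_bij T; have [ke _] := he a Logic.I.
have := temb_beg a; rewrite {1}/beg_pt h0 => /esym.
move/(key _ _ _ _ lu0) => [|bj bu]; first by move: kb; rewrite szE.
have := temb_end a; rewrite {1}/end_pt h1 => /esym.
move/(key _ _ _ _ lu1) => [|ej eu]; first by move: ke; rewrite szE.
split; last by rewrite bj ej.
apply/eqP => be; have : temb (beg_pt a) = temb (end_pt a).
  by rewrite temb_beg temb_end be bj ej.
move/(temb_inj (in_beg a) (in_end a)) => [_ /= /eqP].
by rewrite eq_sym oner_eq0.
Qed.

Definition phi : operad_map (tangle_operad R) (wiring_operad R I) :=
  @OperadMap (tangle_operad R) (wiring_operad R I) phi_colour
    (fun r ss c T => phi_tangle T) phi_eq phi_comp phi_act phi_unit.

End Phi.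

Section Categories.

Variables (k : fieldType) (R : realType) (I : countType).

Definition CA : category := algebra_category k (wiring_operad R I).
Definition PA : category := algebra_category k (tangle_operad R).

Definition phi_star (lab : nat -> I) (lab_inj : injective lab) :
  functor CA PA := restriction k (phi R lab_inj).

End Categories.

(* Main.v *)
Require Import Defs.
From HB Require Import structures.
From mathcomp Require Import all_boot all_algebra all_reals.
From mathcomp Require Import boolp.

(** The statement holds for the restriction functor along any operad map phi,
    by the adjoint functor argument.  Given an algebra V over the source, take
    all terms built from elements of V (as generators), vector space operations
    and operations of the target operad, and identify two terms when they have
    the same value in W for all target algebras W and all homomorphisms from V
    to the restriction of W.  The terms serve as a small solution set.  Since
    the identification is tested in algebras, every algebra axiom holds in the
    quotient, and evaluation of terms is its universal property. *)

Set Implicit Arguments.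
Unset Strict Implicit.
Unset Printing Implicit Defensive.

Import GRing.Theory.

Local Open Scope ring_scope.

(** Only the object part of the left adjoint is given: its action on morphisms is the extension of
    [compm (eta Y) f], and uniqueness of extensions gives the functor laws. Composition with [eta]
    is the bijection of hom-sets, with inverse [ext]. *)
Lemma left_adjoint_of_universal_arrows (C D : category) (G : functor D C)
    (L : Ob C -> Ob D) (eta : forall X : Ob C, Defs.Hom X (G (L X)))
    (ext : forall (X : Ob C) (Y : Ob D), Defs.Hom X (G Y) -> Defs.Hom (L X) Y)
    (ext_eta : forall (X : Ob C) (Y : Ob D) (f : Defs.Hom X (G Y)),
      compm (fmap G (ext X Y f)) (eta X) = f)
    (eta_epi : forall (X : Ob C) (Y : Ob D) (h h' : Defs.Hom (L X) Y),
      compm (fmap G h) (eta X) = compm (fmap G h') (eta X) -> h = h') :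
  exists F : functor C D, left_adjoint F G.
Proof.
pose Lmap (X Y : Ob C) (f : Defs.Hom X Y) := ext _ _ (compm (eta Y) f).
have Lmap_eta (X Y : Ob C) (f : Defs.Hom X Y) :
    compm (fmap G (Lmap X Y f)) (eta X) = compm (eta Y) f.
  exact: ext_eta.
have Lid (X : Ob C) : Lmap X X (idm X) = idm (L X).
  by apply: eta_epi; rewrite Lmap_eta fmap_id compm_idl compm_idr.
have Lcomp (X Y Z : Ob C) (g : Defs.Hom Y Z) (f : Defs.Hom X Y) :
    Lmap X Z (compm g f) = compm (Lmap Y Z g) (Lmap X Y f).
  apply: eta_epi.
  by rewrite Lmap_eta fmap_comp -compmA Lmap_eta [RHS]compmA Lmap_eta compmA.
exists (Functor Lid Lcomp), (fun (X : Ob C) (Y : Ob D) h => compm (fmap G h) (eta X)); split.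
  move=> X Y; exists (ext X Y) => [h|f]; last exact: ext_eta.
  by apply: eta_epi; rewrite ext_eta.
move=> X X' Y Y' f g h /=.
by rewrite !fmap_comp -!compmA Lmap_eta.
Qed.

(** * Terms and their quotient *)

Section FreeAlgebra.

Variables (k : fieldType) (O O' : operad) (phi : operad_map O O').
Variable V : algebra k O.

(** Negation needs no constructor, being scaling by -1. *)
Inductive term : colour O' -> Type :=
| Gen c (v : V c) : term (phi c)
| Zero c : term c
| Add c (t u : term c) : term c
| Scale c (a : k) (t : term c) : term c
| Act r (cs : 'I_r -> colour O') c (D : op cs c)
    (t : forall j, term (cs j)) : term c.

Fixpoint eval (W : algebra k O') (f : algebra_hom V (restrict_obj phi W)) c
    (t : term c) : W c :=
  match t with
  | Gen c v => f c v
  | Zero c => 0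
  | Add c t u => eval f t + eval f u
  | Scale c a t => a *: eval f t
  | Act r cs c D t => act D (fun j => eval f (t j))
  end.

(** The quantification over all [W] stays in the impredicative Prop, so the quotient is no larger
    than the type of terms. *)
Definition term_equiv c (t u : term c) : bool :=
  `[< forall (W : algebra k O') (f : algebra_hom V (restrict_obj phi W)),
        eval f t = eval f u >].

Lemma term_equiv_refl c : reflexive (@term_equiv c).
Proof. by move=> t; apply/asboolP. Qed.

Lemma term_equiv_sym c : symmetric (@term_equiv c).
Proof. by move=> t u; apply/asboolP/asboolP => tu W f. Qed.

Lemma term_equiv_trans c : transitive (@term_equiv c).
Proof.
by move=> u t v /asboolP tu /asboolP uv; apply/asboolP => W f; rewrite tu.
Qed.

(** Classical equality and choice on terms, from which the quotient obtains representatives. *)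
HB.instance Definition _ c := gen_eqMixin (term c).
HB.instance Definition _ c := gen_choiceMixin (term c).

Canonical term_equiv_rel c := EquivRel (@term_equiv c) (@term_equiv_refl c)
  (@term_equiv_sym c) (@term_equiv_trans c).

Definition free_carrier c := {eq_quot (@term_equiv_rel c)}%qT.

HB.instance Definition _ c := Choice.on (free_carrier c).

Definition cls c (t : term c) : free_carrier c := (\pi_(free_carrier c) t)%qT.

Definition evalq (W : algebra k O') (f : algebra_hom V (restrict_obj phi W)) c
    (x : free_carrier c) : W c := eval f (repr x).

Lemma evalq_cls W (f : algebra_hom V (restrict_obj phi W)) c (t : term c) :
  evalq f (cls t) = eval f t.
Proof.
rewrite /evalq; have : (repr (cls t) == t %[mod free_carrier c])%qT.
  by rewrite reprK.
by rewrite eqmodE => /asboolP.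
Qed.

Lemma clsK c (x : free_carrier c) : cls (repr x) = x.
Proof. exact: reprK. Qed.

(** Evaluations jointly separate classes, by the choice of [term_equiv]. This reduces each identity
    in the quotient to one in an arbitrary [W]. *)
Lemma evalq_ext c (x y : free_carrier c) :
  (forall W (f : algebra_hom V (restrict_obj phi W)), evalq f x = evalq f y) ->
  x = y.
Proof.
by move=> xy; rewrite -(clsK x) -(clsK y); apply/eqmodP/asboolP.
Qed.

(** * Vector space structure on classes *)

Definition free_zero c : free_carrier c := cls (Zero c).
Definition free_opp c (x : free_carrier c) := cls (Scale (-1) (repr x)).
Definition free_add c (x y : free_carrier c) := cls (Add (repr x) (repr y)).
Definition free_scale c a (x : free_carrier c) := cls (Scale a (repr x)).

Lemma evalq_zero W f c : @evalq W f c (free_zero c) = 0.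
Proof. exact: evalq_cls. Qed.
Lemma evalq_opp W f c x : @evalq W f c (free_opp x) = - evalq f x.
Proof. by rewrite evalq_cls /= scaleN1r. Qed.
Lemma evalq_add W f c x y :
  @evalq W f c (free_add x y) = evalq f x + evalq f y.
Proof. exact: evalq_cls. Qed.
Lemma evalq_scale W f c a x : @evalq W f c (free_scale a x) = a *: evalq f x.
Proof. exact: evalq_cls. Qed.

Let evalqE := (evalq_zero, evalq_opp, evalq_add, evalq_scale).

Lemma free_addA c : associative (@free_add c).
Proof. by move=> x y z; apply: evalq_ext => W f; rewrite !evalqE addrA. Qed.
Lemma free_addC c : commutative (@free_add c).
Proof. by move=> x y; apply: evalq_ext => W f; rewrite !evalqE addrC. Qed.
Lemma free_add0 c : left_id (free_zero c) (@free_add c).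
Proof. by move=> x; apply: evalq_ext => W f; rewrite !evalqE add0r. Qed.
Lemma free_addN c : left_inverse (free_zero c) (@free_opp c) (@free_add c).
Proof. by move=> x; apply: evalq_ext => W f; rewrite !evalqE addNr. Qed.

HB.instance Definition _ c := GRing.isZmodule.Build (free_carrier c)
  (@free_addA c) (@free_addC c) (@free_add0 c) (@free_addN c).

Lemma free_scaleA c a b (x : free_carrier c) :
  free_scale a (free_scale b x) = free_scale (a * b) x.
Proof. by apply: evalq_ext => W f; rewrite !evalqE scalerA. Qed.
Lemma free_scale1 c : left_id 1 (@free_scale c).
Proof. by move=> x; apply: evalq_ext => W f; rewrite !evalqE scale1r. Qed.
Lemma free_scaleDr c : right_distributive (@free_scale c) +%R.
Proof. by move=> a x y; apply: evalq_ext => W f; rewrite !evalqE scalerDr. Qed.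
Lemma free_scaleDl c (x : free_carrier c) :
  {morph (@free_scale c)^~ x : a b / a + b}.
Proof. by move=> a b; apply: evalq_ext => W f; rewrite !evalqE scalerDl. Qed.

HB.instance Definition _ c := GRing.Zmodule_isLmodule.Build k (free_carrier c)
  (@free_scaleA c) (@free_scale1 c) (@free_scaleDr c) (@free_scaleDl c).

Lemma evalq_linear W f c : linear (@evalq W f c).
Proof. by move=> a x y; rewrite evalq_add evalq_scale. Qed.

(** * Algebra structure on classes *)

Definition free_data : algebra_data k O' :=
  AlgebraData (carrier := fun c => free_carrier c : lmodType k)
    (fun r cs c D x => cls (Act D (fun j => repr (x j)))).

Lemma evalq_act W f r (cs : 'I_r -> colour O') c (D : op cs c)
    (x : forall j, free_data (cs j)) :
  @evalq W f c (act D x) = act D (fun j => evalq f (x j)).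
Proof. exact: evalq_cls. Qed.

Lemma free_is_algebra : is_algebra free_data.
Proof.
split=> [r cs c D i a x y z zi xyz|r cs c D D' DD' x|r s e c i D D' D'' DD' x xi
  |r cs c s D D' DD' x|c D Du x]; apply: evalq_ext => W f.
- rewrite evalq_linear !evalq_act.
  apply: (act_multilinear (algebraP W) D (i := i)).
    by rewrite zi; exact: evalq_linear.
  by move=> j /xyz[-> ->].
- by rewrite !evalq_act; exact: (act_eq (algebraP W) DD').
- rewrite !evalq_act.
  apply: (act_comp (algebraP W) DD' (x := fun z => evalq f (x z))).
  (* The condition on slot [i] is an equation of classes, so it must be evaluated too. *)
  by rewrite xi evalq_act.
- rewrite !evalq_act.
  exact: (act_act (algebraP W) DD' (fun j => evalq f (x j))).
- by rewrite evalq_act; exact: (act_unit (algebraP W) Du).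
Qed.

Definition free_algebra : algebra k O' := Algebra free_is_algebra.

(** * Universal property *)

Lemma evalq_is_hom W (f : algebra_hom V (restrict_obj phi W)) :
  is_algebra_hom (V := free_algebra) (W := W) (@evalq W f).
Proof.
by split=> [c|r cs c D x]; [exact: evalq_linear|exact: evalq_act].
Qed.

Definition free_ext W (f : algebra_hom V (restrict_obj phi W)) :
  algebra_hom free_algebra W := AlgebraHom (evalq_is_hom f).

(** Terms are tested only through homomorphisms [f] out of [V], so the relations of [V] hold between
    classes of generators. *)
Lemma free_unit_is_hom :
  is_algebra_hom (V := V) (W := restrict_obj phi free_algebra)
    (fun c v => cls (Gen v)).
Proof.
split=> [c a x y|r cs c D x]; apply: evalq_ext => W f.
  by rewrite evalq_linear !evalq_cls /=; case: (hom_funP f) => ->.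
rewrite evalq_act evalq_cls /=; case: (hom_funP f) => _ -> /=.
by congr act; apply: functional_extensionality_dep => j; rewrite evalq_cls.
Qed.

Definition free_unit : algebra_hom V (restrict_obj phi free_algebra) :=
  AlgebraHom free_unit_is_hom.

(** Uniqueness of extensions, by induction on terms. Keeping [f] separate from [h] lets two
    homomorphisms be compared with the same evaluation. *)
Lemma eval_hom (W : algebra k O') (h : algebra_hom free_algebra W)
    (f : algebra_hom V (restrict_obj phi W)) :
  (forall c (v : V c), h (phi c) (cls (Gen v)) = f c v) ->
  forall c (t : term c), h c (cls t) = eval f t.
Proof.
case: (hom_funP h) => hlin hact hf c t.
have h0 c' : h c' 0 = 0.
  (* For these arguments linearity reads [h 0 = - h 0 + h 0]. *)
  by have := hlin c' (-1) 0 0; rewrite scaler0 addr0 scaleN1r addNr.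
have hZ c' a x : h c' (a *: x) = a *: h c' x.
  by have := hlin c' a x 0; rewrite h0 !addr0.
have hD c' x y : h c' (x + y) = h c' x + h c' y.
  by have := hlin c' 1 x y; rewrite !scale1r.
elim: t => {c} [c v|c|c t IHt u IHu|c a t IHt|r cs c D t IHt] /=.
- exact: hf.
- by rewrite -h0.
- rewrite -IHt -IHu -hD; congr (h c _).
  by apply: evalq_ext => W' f'; rewrite evalq_add !evalq_cls.
- rewrite -IHt -hZ; congr (h c _).
  by apply: evalq_ext => W' f'; rewrite evalq_scale !evalq_cls.
(* The action on classes goes through chosen representatives, so its agreement with the class of
   [Act D t] is checked by evaluation before [hact] applies. *)
- transitivity (h c (act D (fun j => cls (t j) : free_algebra (cs j)))).
    congr (h c _); apply: evalq_ext => W' f'; rewrite evalq_act evalq_cls /=.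
    by congr act; apply: functional_extensionality_dep => j; rewrite evalq_cls.
  by rewrite hact; congr act; apply: functional_extensionality_dep => j.
Qed.

End FreeAlgebra.

Theorem restriction_left_adjoint (k : fieldType) (O O' : operad)
    (phi : operad_map O O') :
  exists phi_shriek : functor (algebra_category k O) (algebra_category k O'),
    left_adjoint phi_shriek (restriction k phi).
Proof.
apply: (@left_adjoint_of_universal_arrows _ _ (restriction k phi)
  (free_algebra phi) (free_unit phi) (fun V W f => free_ext f)) => V W.
  by move=> f; apply: algebra_hom_eq => c v /=; rewrite evalq_cls.
move=> h h' hh'; apply: algebra_hom_eq => c x; rewrite -(clsK x).
(* The common restriction of [h] and [h'] to generators, built from [h']; for [h] it is supplied by
   [hh']. *)
pose f : algebra_hom V (restrict_obj phi W) :=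
  @compm (algebra_category k O) _ _ _ (fmap (restriction k phi) h')
    (free_unit phi V).
rewrite (@eval_hom _ _ _ _ _ _ h f) ?(@eval_hom _ _ _ _ _ _ h' f) // => c' v.
exact: (congr1 (fun g : algebra_hom V (restrict_obj phi W) => g c' v) hh').
Qed.

(* I is the set of labels; the label of the positive integer j + 1 is lab j. *)
Theorem proposition3p3 (k : fieldType) (k_char0 : [pchar k] =i pred0)
    (R : realType) (I : countType) (lab : nat -> I)
    (lab_inj : injective lab) :
  exists phi_shriek : functor (PA k R) (CA k R I),
    left_adjoint phi_shriek (phi_star k R lab_inj).
Proof. exact: restriction_left_adjoint. Qed.
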